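(* Suppose that $G$ is a locally compact non-discrete group. Then neither $G^{luc}$ nor $G^*=G^{luc}\setminus G$ is an F-space.
   Context: Locally compact groups are Hausdorff and functions are complex-valued. $C_b(G)$ is the Banach space of bounded continuous functions on $G$ with the uniform norm; for $g\in G$, $l_gf(x)=f(gx)$. $LUC(G)$ is the $C^*$-algebra of all $f\in C_b(G)$ such that $g\mapsto l_gf$ is continuous from $G$ to $C_b(G)$ (norm topology). $G^{luc}$ is the Gelfand spectrum of $LUC(G)$, i.e. the set of nonzero multiplicative linear functionals in $LUC(G)^*$, with the weak-star topology; it is compact Hausdorff. $G$ is identified with its image in $G^{luc}$ under point evaluations, and $G^*=G^{luc}\setminus G$ carries the subspace topology. A completely regular space $X$ is an F-space if for every bounded continuous function $f$ on $X$ there is a bounded continuous function $k$ on $X$ with $f=k|f|$.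
   Formalization: The claim that G^* is not an F-space is proved for non-compact G only: for compact G the space G^* is empty and is vacuously an F-space, so the claim as written fails there. *)

(* Defs.v *)
From HB Require Import structures.
From mathcomp Require Import all_boot all_order all_algebra.
From mathcomp Require Import all_classical all_reals all_analysis.
From mathcomp Require Import complex.

Set Implicit Arguments.
Unset Strict Implicit.
Unset Printing Implicit Defensive.

Import Order.TTheory GRing.Theory Num.Theory.
Import numFieldNormedType.Exports.

Local Open Scope classical_set_scope.
Local Open Scope ring_scope.

(* The usual topology and norm of the complex plane: R[i] is a numFieldType,
   so these are the ones the library puts on its regular module R[i]^o. *)
HB.instance Definition _ (R : realType) := NormedModule.copy R[i] (R[i]^o).

HB.mixin Record isTopologicalGroup G & Group G & Topological G := {
  mulg_continuous : continuous (fun p : G * G => (p.1 * p.2)%g) ;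
  invg_continuous : continuous (fun x : G => (x^-1)%g)
}.

#[short(type="topologicalGroupType")]
HB.structure Definition TopologicalGroup :=
  {G of Group G & Topological G & isTopologicalGroup G}.

(* The complex modulus as an element of R (`|z| itself lives in R[i]). *)
Notation normc := Normc.normc.

Lemma normrE (R : realType) (z : R[i]) : `|z| = (normc z)%:C%C.
Proof. by rewrite normc_def; case: z. Qed.

Lemma normc_ge0 (R : realType) (z : R[i]) : 0 <= normc z.
Proof. by rewrite -lecR -normrE normr_ge0. Qed.

Section bounded_continuous.
Context {R : realType}.

Definition Cb (X : topologicalType) : set (X -> R[i]) :=
  [set f | continuous f /\ bounded_fun f].

Definition sup_norm (X : Type) (f : X -> R[i]) : R :=
  sup [set normc (f x) | x in [set: X]].

Lemma bounded_funP (X : Type) (f : X -> R[i]) :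
  bounded_fun f <-> exists M : R, forall x, normc (f x) <= M.
Proof.
split=> [[N [Nr Nf]]|[M Mf]].
- have N1 : N < (`|complex.Re N| + 1)%:C%C.
    move: Nr; rewrite -[N]/(_ : R[i]) => /RRe_real <-; rewrite ltcR /=.
    by rewrite (le_lt_trans (ler_norm _))// ltrDl.
  exists (`|complex.Re N| + 1) => x.
  by have := Nf _ N1 x I; rewrite /= normrE lecR.
- exists M%:C%C; split; first by rewrite complex_real.
  by move=> y My x _ /=; apply: le_trans (ltW My); rewrite normrE lecR.
Qed.

Lemma sup_norm_le (X : Type) (f : X -> R[i]) (e : R) : 0 <= e ->
  (forall x, normc (f x) <= e) -> sup_norm f <= e.
Proof.
move=> e0 fe; have [[x _]|/nonemptyPn X0] := pselect ([set: X] !=set0).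
  apply: ge_sup; first by exists (normc (f x)); exists x.
  by move=> _ [y _ <-].
by rewrite /sup_norm X0 image_set0 sup0.
Qed.

Lemma le_sup_norm (X : Type) (f : X -> R[i]) x :
  bounded_fun f -> normc (f x) <= sup_norm f.
Proof.
move=> /bounded_funP[M fM]; apply: ub_le_sup; last by exists x.
by exists M => _ [y _ <-].
Qed.

End bounded_continuous.

(* A notion for completely regular spaces; complete regularity of X is not
   repeated as a conjunct, so that "not an F-space" always means that some f
   has no such k. *)
Definition F_space (R : realType) (X : topologicalType) :=
  forall f : X -> R[i], Cb f ->
    exists2 k : X -> R[i], Cb k & forall x, f x = k x * `|f x|.

Section LUC.
Context {R : realType} {G : topologicalGroupType}.

Definition left_translate (g : G) (f : G -> R[i]) : G -> R[i] :=
  fun x => f (g * x)%g.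

Definition is_LUC (f : G -> R[i]) := Cb f /\
  forall g0 : G, (fun g : G =>
    sup_norm (left_translate g f \- left_translate g0 f)) @ g0 --> (0 : R).

Definition LUC_pred : {pred G -> R[i]} := fun f => `[< is_LUC f >].

Lemma is_LUCP (f : G -> R[i]) : is_LUC f <-> Cb f /\
  forall g0 (e : R), 0 < e ->
    \forall g \near g0, forall x, normc (f (g * x)%g - f (g0 * x)%g) <= e.
Proof.
have dP g g0 : bounded_fun f ->
    bounded_fun (left_translate g f \- left_translate g0 f).
  move=> /bounded_funP[M fM]; apply/bounded_funP; exists (M + M) => y.
  apply: le_trans (le_normcD _ _) _.
  by rewrite normcN lerD// /left_translate fM.
split=> -[[cf bf] fc]; split=> // g0.
- move=> e e0; have /cvgr0Pnorm_lt /(_ e e0) := fc g0.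
  apply: filterS => g ge x; apply: le_trans (ltW (le_lt_trans (ler_norm _) ge)).
  exact: (le_sup_norm x (dP g g0 bf)).
- apply/cvgr0Pnorm_le => e e0; apply: filterS (fc g0 e e0) => g ge.
  rewrite ger0_norm; first exact: sup_norm_le (ltW e0) _.
  by apply: le_trans (normc_ge0 _) (le_sup_norm 1%g (dP g g0 bf)).
Qed.

Lemma LUC_predP (f : G -> R[i]) : reflect (is_LUC f) (f \in LUC_pred).
Proof. exact: asboolP. Qed.

Lemma is_LUC1 : is_LUC 1.
Proof.
apply/is_LUCP; split; first split.
- by move=> x; exact: cvg_cst.
- by apply/bounded_funP; exists 1 => x; rewrite Normc.normc1.
- move=> g0 e e0; apply: nearW => g x.
  by rewrite subrr Normc.normc0 ltW.
Qed.

Lemma is_LUCB (f h : G -> R[i]) : is_LUC f -> is_LUC h -> is_LUC (f - h).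
Proof.
move=> /is_LUCP[[cf /bounded_funP[M fM]] uf].
move=> /is_LUCP[[ch /bounded_funP[N hN]] uh].
apply/is_LUCP; split; first split.
- by move=> x; apply: cvgB; [exact: cf|exact: ch].
- apply/bounded_funP; exists (M + N) => x.
  by apply: le_trans (le_normcD _ _) _; rewrite normcN lerD.
- move=> g0 e e0; have e2 : 0 < e / 2 by rewrite divr_gt0.
  apply: filterS2 (uf g0 _ e2) (uh g0 _ e2) => g fg hg x.
  have -> : (f - h) (g * x)%g - (f - h) (g0 * x)%g =
    (f (g * x)%g - f (g0 * x)%g) - (h (g * x)%g - h (g0 * x)%g).
    by rewrite !fctE !opprB [X in _ + X = _]addrC addrACA [- h _ + _]addrC.
  apply: le_trans (le_normcD _ _) _; rewrite normcN [e]splitr lerD//.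
Qed.

Lemma is_LUCM (f h : G -> R[i]) : is_LUC f -> is_LUC h -> is_LUC (f * h).
Proof.
move=> /is_LUCP[[cf /bounded_funP[M fM]] uf].
move=> /is_LUCP[[ch /bounded_funP[N hN]] uh].
have M0 : 0 <= M by apply: le_trans (normc_ge0 (f 1%g)) _.
have N0 : 0 <= N by apply: le_trans (normc_ge0 (h 1%g)) _.
apply/is_LUCP; split; first split.
- by move=> x; apply: cvgM; [exact: cf|exact: ch].
- apply/bounded_funP; exists (M * N) => x.
  by rewrite Normc.normcM ler_pM// normc_ge0.
- move=> g0 e e0; pose d := e / 2 / (M + N + 1).
  have MN0 : 0 < M + N + 1 by rewrite ltr_wpDl// addr_ge0.
  have d0 : 0 < d by rewrite !divr_gt0.
  apply: filterS2 (uf g0 _ d0) (uh g0 _ d0) => g fg hg x.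
  have -> : (f * h) (g * x)%g - (f * h) (g0 * x)%g =
    f (g * x)%g * (h (g * x)%g - h (g0 * x)%g) +
    (f (g * x)%g - f (g0 * x)%g) * h (g0 * x)%g.
    by rewrite !fctE mulrBr mulrBl subrKA.
  apply: le_trans (le_normcD _ _) _; rewrite !Normc.normcM.
  have -> : e = (M + N + 1) * d + (M + N + 1) * d.
    by rewrite /d mulrC divfK ?gt_eqF// -splitr.
  apply: lerD.
  + apply: ler_pM; rewrite ?normc_ge0//.
    by apply: le_trans (fM _) _; rewrite -addrA lerDl addr_ge0.
  + rewrite mulrC; apply: ler_pM; rewrite ?normc_ge0//.
      by apply: le_trans (hN _) _; rewrite addrAC lerDr addr_ge0.
Qed.

Lemma is_LUC_cst (a : R[i]) : is_LUC (cst a).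
Proof.
apply/is_LUCP; split; first split.
- by move=> x; exact: cvg_cst.
- by apply/bounded_funP; exists (normc a).
- by move=> g0 e e0; apply: nearW => g x; rewrite subrr Normc.normc0 ltW.
Qed.

Fact LUC_subring : subring_closed LUC_pred.
Proof.
split=> [|f h|f h]; first exact/LUC_predP/is_LUC1.
- by move=> /LUC_predP fL /LUC_predP hL; exact/LUC_predP/is_LUCB.
- by move=> /LUC_predP fL /LUC_predP hL; exact/LUC_predP/is_LUCM.
Qed.

Fact LUC_submod : subsemimod_closed LUC_pred.
Proof.
have [_ LB LM] := LUC_subring.
have L0 : 0 \in LUC_pred by rewrite -(subrr 1) LB//; exact/LUC_predP/is_LUC1.
split; first split=> // f h fL hL.
- by rewrite -[h]opprK LB// -sub0r LB.
- by move=> a f fL; exact: (LM (cst a) f (introT (LUC_predP _) (is_LUC_cst a))).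
Qed.

End LUC.

Arguments LUC_pred R G : clear implicits.

(* The algebra LUC(G), with pointwise operations. *)
Record LUC (R : realType) (G : topologicalGroupType) :=
  MkLUC { LUC_fun :> G -> R[i] ; _ : LUC_fun \in LUC_pred R G }.

Section LUC_algebra.
Context {R : realType} {G : topologicalGroupType}.

HB.instance Definition _ := [isSub for @LUC_fun R G].
HB.instance Definition _ := [Choice of LUC R G by <:].
HB.instance Definition _ :=
  GRing.SubChoice_isSubComPzRing.Build _ (LUC_pred R G) (LUC R G) LUC_subring.
HB.instance Definition _ :=
  GRing.SubNmodule_isSubLSemiModule.Build _ _ (LUC_pred R G) (LUC R G) LUC_submod.

End LUC_algebra.

Section luc_compactification.
Context (R : realType) (G : topologicalGroupType).

(* Nonzero multiplicative elements of the dual LUC(G)^*. *)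
Definition is_character (phi : LUC R G -> R[i]) := [/\ scalar phi,
  exists M : R, forall f : LUC R G, normc (phi f) <= M * sup_norm f,
  {morph phi : f h / f * h} &
  exists f, phi f != 0].

(* The weak-star topology is the topology of pointwise convergence on LUC(G). *)
Definition Gluc : topologicalType :=
  set_type ([set phi | is_character phi] : set {ptws LUC R G -> R[i]}).

Definition Gluc_fun (phi : Gluc) : LUC R G -> R[i] := set_val phi.

Definition point_eval (x : G) : LUC R G -> R[i] := fun f => f x.

Lemma point_evalP x : is_character (point_eval x).
Proof.
split=> //.
- exists 1 => f; rewrite mul1r /point_eval le_sup_norm//.
  by have /LUC_predP[[]] := valP f.
- by exists 1; rewrite /point_eval oner_neq0.
Qed.

Definition Gluc_inj (x : G) : Gluc :=
  exist _ (point_eval x) (mem_set (point_evalP x)).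

Definition Gstar : topologicalType := set_type (~` range Gluc_inj).

End luc_compactification.

(* Main.v *)
(* A non-discrete locally compact G carries a continuous length N with
   relatively compact small balls, and points x_n with N(x_n) between 2^-(n+1)
   and 2^-n.  Some Lipschitz phi is positive at each N(x_4n) and negative at each
   N(x_(4n+2)); then phi o N changes sign arbitrarily close to 1: a cluster
   point p of the x_4n has length 0, and left translation by p^-1 preserves N
   and moves x_4n close to 1 (likewise for x_(4n+2)).  So phi o N has no
   continuous phase at 1, and pulling back along G -> G^luc settles G^luc.

   For G^*, take a sequence g with N(g_n g_m^-1) >= 1/2, let D(z) be the
   infimum of the N(z g_n^-1), and let q be the limit of g along a free
   ultrafilter.  The orbit map x |-> x q is a continuous map G -> G^*, and near
   1 the extension of phi o D to G^luc takes the value phi(N x) at x q, with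
   the same sign changes.  Freeness of the action on G^luc is never needed. *)

Require Import Defs.
From mathcomp Require Import all_boot all_order all_algebra.
From mathcomp Require Import all_classical all_reals all_analysis.
From mathcomp Require Import complex lra zify.

Import Order.TTheory GRing.Theory Num.Theory.
Import numFieldNormedType.Exports Defs.

Set Implicit Arguments.
Unset Strict Implicit.
Unset Printing Implicit Defensive.

Local Open Scope classical_set_scope.
Local Open Scope ring_scope.

(** * Words in a sequence of neighbourhoods and their weights *)

Section chain_length.
Context (R : realType) (G : groupType) (U : nat -> set G).

Definition weight (s : seq nat) : R := \sum_(i <- s) 2 ^- i.

(** The product set of the [U i], with [i] running through [s] from left to right. *)
Fixpoint word (s : seq nat) : set G :=
  if s is i :: s' then [set x | exists2 a, U i a & word s' (a^-1 * x)%g]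
  else [set 1%g].

Lemma pow2_gt0 n : 0 < 2 ^- n :> R.
Proof. by rewrite invr_gt0 exprn_gt0. Qed.

Lemma pow2S n : 2 * 2 ^- n.+1 = 2 ^- n :> R.
Proof. by rewrite exprS invfM mulrA divff ?mul1r. Qed.

Lemma pow2_le m n : (m <= n)%N -> 2 ^- n <= 2 ^- m :> R.
Proof. by move=> mn; rewrite lef_pV2 ?posrE ?exprn_gt0// ler_eXn2l// ltr1n. Qed.

Lemma pow2_lt_le m n : 2 ^- n < 2 ^- m :> R -> (m < n)%N.
Proof. by apply: contraTT; rewrite -leqNgt -leNgt; exact: pow2_le. Qed.

Lemma weight_ge0 s : 0 <= weight s.
Proof. by apply: sumr_ge0 => i _; rewrite ltW ?pow2_gt0. Qed.

Lemma weight_cat s t : weight (s ++ t) = weight s + weight t.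
Proof. exact: big_cat. Qed.

Lemma weight_cons i s : weight (i :: s) = 2 ^- i + weight s.
Proof. exact: big_cons. Qed.

Lemma word_cat s t z :
  word (s ++ t) z <-> exists2 x, word s x & word t (x^-1 * z)%g.
Proof.
elim: s z => [|i s IH] z /=.
  split=> [tz|[_ -> ]]; last by rewrite invg1 mul1g.
  by exists 1%g => //; rewrite invg1 mul1g.
split=> [[a Ua /IH[x sx tx]]|[x [a Ua sax] tx]].
  exists (a * x)%g; last by rewrite invgM -mulgA.
  by exists a => //; rewrite mulKg.
by exists a => //; apply/IH; exists (a^-1 * x)%g => //; rewrite invgM invgK -mulgA mulVKg.
Qed.

(** The letter [i] is where the partial sums first exceed [c]; if [c] is half of the total, neither
    side of it weighs more than [c]. *)
Lemma weight_split c s : 0 <= c -> c < weight s ->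
  exists s1 i s2, [/\ s = s1 ++ i :: s2, weight s1 <= c &
    c < weight s1 + 2 ^- i].
Proof.
elim: s c => [|i s IH] c c0; first by rewrite /weight big_nil ltNge c0.
rewrite weight_cons => cs; have [ci|ic] := ltP c (2 ^- i).
  by exists [::], i, s; rewrite /weight big_nil add0r.
have [||s1 [j [s2 [-> s1c cs1]]]] := IH (c - 2 ^- i); [lra..|].
exists (i :: s1), j, s2; rewrite weight_cons; split=> //; lra.
Qed.

Hypothesis U1 : forall n, U n 1%g.
Hypothesis UV : forall n x, U n x -> U n (x^-1)%g.
Hypothesis UM : forall n x y z, U n.+1 x -> U n.+1 y -> U n.+1 z ->
  U n (x * y * z)%g.

Lemma U_decr m n x : (m <= n)%N -> U n x -> U m x.
Proof.
move=> /subnK <-; elim: (n - m)%N => [//|k IH] Ux; apply: IH.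
by rewrite -[x]mulg1 -[x]mulg1; exact: UM.
Qed.

Lemma word_sub m s x : weight s < 2 ^- m -> word s x -> U m x.
Proof.
(* Cut s at half of its weight: the two sides and the letter at the cut all
   lie in U m.+1. *)
have [k] := ubnP (size s); elim: k => // k IH in m s x *.
rewrite ltnS => sk sm; have [->|s0] := eqVneq s [::]; first by move=> ->.
have w0 : 0 < weight s.
  case: s s0 {sk sm} => // i s _; rewrite weight_cons.
  by rewrite ltr_wpDr ?weight_ge0 ?pow2_gt0.
have [||s1 [i [s2 [es s1w ws1]]]] := @weight_split (weight s / 2) s; [lra..|].
move: sk w0 sm s1w ws1; rewrite {s s0}es size_cat /= weight_cat weight_cons.
move=> sk w0 sm s1w ws1 /word_cat[y s1y /= [a Ua s2a]].
have := pow2S m; have := weight_ge0 s1; have := weight_ge0 s2.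
have /pow2_lt_le mi : 2 ^- i < 2 ^- m :> R.
  by have := weight_ge0 s1; have := weight_ge0 s2; lra.
move=> s20 s10 pm.
have yU : U m.+1 y by apply: (IH _ s1) => //; [lia|lra].
have zU : U m.+1 (a^-1 * (y^-1 * x))%g by apply: (IH _ s2) => //; [lia|lra].
by have := UM yU (U_decr mi Ua) zU; rewrite -!mulgA mulVKg mulVKg.
Qed.

Lemma word_inv s x : word s x -> word (rev s) (x^-1)%g.
Proof.
elim: s x => [|i s IH] x /=; first by move=> ->; exact: invg1.
move=> [a Ua /IH]; rewrite rev_cons -cats1 => sx; apply/word_cat.
exists ((a^-1 * x)^-1)%g => //; exists (a^-1)%g; first exact: UV.
by rewrite !invgK mulgK mulgV.
Qed.

Lemma weight_rev s : weight (rev s) = weight s.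
Proof. by rewrite /weight big_rev. Qed.

Definition chain_len (x : G) : R := inf [set weight s | s in [set s | word s x]].

Lemma chain_len_le s x : word s x -> chain_len x <= weight s.
Proof.
move=> sx; apply: ge_inf; last by exists s.
by exists 0 => _ [t _ <-]; exact: weight_ge0.
Qed.

Lemma chain_len_le_pow n x : U n x -> chain_len x <= 2 ^- n.
Proof.
move=> Ux; have -> : 2 ^- n = weight [:: n] by rewrite /weight big_seq1.
by apply: chain_len_le; exists x => //; rewrite mulVg.
Qed.

Hypothesis U0 : forall x, U 0 x.

Lemma chain_len_ex e x : chain_len x < e -> exists2 s, word s x & weight s < e.
Proof.
move=> /inf_lt[|]; last by move=> _ [s sx <-] se; exists s.

(* The set under [inf] is nonempty: [U 0] is everything, so [x] is itself a one-letter word. *)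
by exists (weight [:: 0%N]), [:: 0%N] => //=; exists x => //; rewrite mulVg.
Qed.

Lemma chain_len_ge0 x : 0 <= chain_len x.
Proof. by rewrite leNgt; apply/negP => /chain_len_ex[s _]; rewrite ltNge weight_ge0. Qed.

Lemma chain_len1 : chain_len 1%g = 0.
Proof.
apply/eqP; rewrite eq_le chain_len_ge0 andbT.
have -> : 0 = weight [::] by rewrite /weight big_nil.
exact: chain_len_le.
Qed.

Lemma chain_lenV x : chain_len (x^-1)%g = chain_len x.
Proof.
suff le y : chain_len (y^-1)%g <= chain_len y.
  by apply/eqP; rewrite eq_le le -{1}[x]invgK le.
rewrite leNgt; apply/negP => /chain_len_ex[s sy].
by rewrite ltNge -weight_rev chain_len_le//; exact: word_inv.
Qed.

Lemma chain_lenM x y : chain_len (x * y)%g <= chain_len x + chain_len y.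
Proof.
apply/ler_addgt0Pr => e e0; have e2 : 0 < e / 2 by rewrite divr_gt0.
have [s sx sl] := @chain_len_ex (chain_len x + e / 2) x ltac:(lra).
have [t ty tl] := @chain_len_ex (chain_len y + e / 2) y ltac:(lra).
apply: (@le_trans _ _ (weight (s ++ t))); last by rewrite weight_cat; lra.
by apply: chain_len_le; apply/word_cat; exists x => //; rewrite mulKg.
Qed.

(** The reverse bound to [chain_len_le_pow]; it rests on [word_sub], hence on the cube condition
    [UM]. *)
Lemma chain_len_lt_pow n x : chain_len x < 2 ^- n -> U n x.
Proof. by move=> /chain_len_ex[s sx sl]; exact: word_sub sl sx. Qed.

End chain_length.

(** * Translations, neighbourhoods of 1 and the existence of a length *)

Lemma cvg_mulg (G : topologicalGroupType) (T : Type) (F : set_system T)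
    (f g : T -> G) a b : Filter F ->
  f @ F --> a -> g @ F --> b -> (f x * g x)%g @[x --> F] --> (a * b)%g.
Proof. by move=> FF fa gb; exact: (cvg_comp2 fa gb (@mulg_continuous G (a, b))). Qed.

Lemma continuous_lmulg (G : topologicalGroupType) (a : G) :
  continuous (fun x : G => a * x)%g.
Proof. by move=> x; apply: cvg_mulg; [exact: cvg_cst|exact: cvg_id]. Qed.

Lemma continuous_rmulg (G : topologicalGroupType) (a : G) :
  continuous (fun x : G => x * a)%g.
Proof. by move=> x; apply: cvg_mulg; [exact: cvg_id|exact: cvg_cst]. Qed.

Lemma near1_rmulg (G : topologicalGroupType) (a : G) (P : G -> Prop) :
  (\forall x \near 1%g, P x) -> \forall x \near a, P (x * a^-1)%g.
Proof. by move=> nP; apply: (@continuous_rmulg G (a^-1)%g a); rewrite mulgV. Qed.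

(** If 1 were isolated, right translation would make every point isolated. *)
Lemma nondiscrete_near1 (G : topologicalGroupType) (V : set G) :
  ~ (forall A : set G, open A) -> nbhs 1%g V -> exists2 x, V x & x != 1%g.
Proof.
move=> ndG nV; apply: contra_notP ndG => V1 A.
rewrite openE => a Aa; rewrite /interior.
apply: filterS (near1_rmulg a nV) => x Vx; suff -> : x = a by [].
apply/eqP/negPn/negP => xa; apply: V1; exists (x * a^-1)%g => //.
by rewrite divg_eq1.
Qed.

(** The point left out by [W] will bound lengths from below. It exists because 1 is not isolated,
    and it can be removed because points are closed. *)
Lemma nbhs1_refine (G : topologicalGroupType) (V : set G) : hausdorff_space G ->
  ~ (forall A : set G, open A) -> nbhs 1%g V ->
  exists W : set G, [/\ nbhs 1%g W, forall x, W x -> W (x^-1)%g,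
    forall x y z, W x -> W y -> W z -> V (x * y * z)%g &
    exists2 x, V x & ~ W x].
Proof.
move=> hG ndG nV; have [x0 Vx0 x01] := nondiscrete_near1 ndG nV.
have prod2 (A : set G) : nbhs 1%g A ->
    exists2 B : set G, nbhs 1%g B & forall x y, B x -> B y -> A (x * y)%g.
  move=> nA; have : nbhs ((1, 1)%g : G * G) [set p | A (p.1 * p.2)%g].
    by apply: (@mulg_continuous G (1, 1)%g); rewrite /= mulg1.
  move=> [[B C] /= [nB nC] BC]; exists (B `&` C); first exact: filterI.
  by move=> x y [Bx _] [_ Cy]; exact: (BC (x, y)).
have [B nB BV] := prod2 V nV; have [C nC CB] := prod2 B nB.
pose D := B `&` C `&` ~` [set x0].
have nD : nbhs 1%g D.
  apply: filterI; first exact: filterI.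
  apply: open_nbhs_nbhs; split; last by move=> /= e; rewrite e eqxx in x01.
  exact/closed_openC/accessible_closed_set1/hausdorff_accessible.
exists (D `&` [set x | D (x^-1)%g]); split.
- by apply: filterI => //; apply: (@invg_continuous G 1%g); rewrite /= invg1.
- by move=> x [Dx DVx]; split=> //=; rewrite invgK.
- by move=> x y z [[[_ Cx] _] _] [[[_ Cy] _] _] [[[Bz _] _] _]; exact/BV/Bz/CB.
- by exists x0 => // -[[_ /(_ erefl)]].
Qed.

Definition is_length (R : realType) (G : topologicalGroupType) (N : G -> R) :=
  [/\ N 1%g = 0, forall x, N (x^-1)%g = N x,
      forall x y, N (x * y)%g <= N x + N y, forall x, N x <= 1 &
      forall e, 0 < e -> \forall x \near 1%g, N x < e].

(* Birkhoff-Kakutani: the length is the infimum of sum_i 2^-n_i over the ways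
   to write x as a product of elements of the U n_i, where U n is a sequence of
   symmetric neighbourhoods of 1 with (U n.+1)^3 contained in U n. *)
Lemma length_exists (R : realType) (G : topologicalGroupType) :
  hausdorff_space G -> locally_compact [set: G] ->
  ~ (forall A : set G, open A) ->
  exists (N : G -> R) (K : set G) (x : nat -> G), [/\ is_length N, compact K,
    forall y, N y < 2^-1 -> K y &
    forall n, 2 ^- n.+1 <= N (x n) <= 2 ^- n].
Proof.
move=> hG lcG ndG.
have := lcG 1%g I; rewrite withinET => -[K nK [cK _]].
(* [choice] wants a total function, so the claim is void unless [V] is a neighbourhood of 1.
   Intersecting with [K] puts the cube of [U 1] inside [K]. *)
have step (V : set G) : exists W : set G, nbhs 1%g V ->
  [/\ nbhs 1%g W, forall x, W x -> W (x^-1)%g,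
    forall x y z, W x -> W y -> W z -> (V `&` K) (x * y * z)%g &
    exists2 x, V x & ~ W x].
  have [nV|nV] := pselect (nbhs 1%g V); last by exists set0.
  have [W [nW WV WM [x [Vx _] Wx]]] := nbhs1_refine hG ndG (filterI nV nK).
  by exists W; split=> //; exists x.
have [next nextP] := choice step.
pose U n := iter n next setT.
have nU n : nbhs 1%g (U n).
  by elim: n => [|n /nextP[]//]; exact: filterT.
have U1 n : U n 1%g by exact: nbhs_singleton.
have UV n x : U n x -> U n (x^-1)%g.
  by case: n => [//|n]; have [_ + _ _] := nextP _ (nU n); exact.
have UMK n x y z : U n.+1 x -> U n.+1 y -> U n.+1 z -> (U n `&` K) (x * y * z)%g.
  by have [_ _ + _] := nextP _ (nU n); exact.
have UM n x y z : U n.+1 x -> U n.+1 y -> U n.+1 z -> U n (x * y * z)%g.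
  by move=> Ux Uy Uz; have [] := UMK n x y z Ux Uy Uz.
have /choice[x xP] : forall n, exists y, U n y /\ ~ U n.+1 y.
  move=> n.
  by have [_ _ _ [x]] := nextP _ (nU n); exists x.
have U0 y : U 0%N y by [].
exists (chain_len R U), K, x; split=> //.
- split; [exact: chain_len1|exact: chain_lenV|exact: chain_lenM| |].
  + by move=> y; have := @chain_len_le_pow R _ U 0 y (U0 y); rewrite expr0 invr1.
  + move=> e e0; have [n ne] : exists n, 2 ^- n < e :> R.
      have /cvgrPdist_lt /(_ e e0)[n _ /(_ n (leqnn n)) /=] :=
        @cvg_geometric R 1 2^-1 ltac:(rewrite ger0_norm; lra).
      by rewrite sub0r normrN /geometric/= mul1r exprVn ger0_norm ?ltW ?pow2_gt0//; exists n.
    apply: filterS (nU n) => y Uy.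
    by apply: le_lt_trans ne; exact: chain_len_le_pow.
- move=> y yl.
  have U1y : U 1%N y by apply: (@chain_len_lt_pow R _ U) => //; rewrite expr1.
  by have [_] := UMK 0%N _ _ _ U1y (U1 1%N) (U1 1%N); rewrite !mulg1.
- move=> n; have [Ux nUx] := xP n; rewrite chain_len_le_pow// andbT.
  by rewrite leNgt; apply/negP => /chain_len_lt_pow; auto.
Qed.

(** * Infima of sequences and a Lipschitz function of prescribed sign *)

Section infimum_of_sequence.
Context {R : realType}.

Definition infn (F : nat -> R) : R := inf (range F).

Lemma infn_le F n : (forall m, 0 <= F m) -> infn F <= F n.
Proof.
by move=> F0; apply: ge_inf; [exists 0 => _ [m _ <-]|exists n].
Qed.

Lemma le_infn F e : (forall m, e <= F m) -> e <= infn F.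
Proof.
by move=> Fe; apply: lb_le_inf => [|_ [m _ <-]//]; exists (F 0%N), 0%N.
Qed.

Lemma infn_dist F H c : (forall m, 0 <= F m) -> (forall m, 0 <= H m) ->
  (forall m, `|F m - H m| <= c) -> `|infn F - infn H| <= c.
Proof.
have le F1 F2 : (forall m, 0 <= F1 m) -> (forall m, `|F1 m - F2 m| <= c) ->
    infn F1 <= infn F2 + c.
  move=> F10 Fc; rewrite -lerBlDr; apply: le_infn => m.
  have := infn_le m F10; have := Fc m; rewrite ler_norml => /andP[]; lra.
move=> F0 H0 FH; have HF m : `|H m - F m| <= c by rewrite distrC.
have := le _ _ F0 FH; have := le _ _ H0 HF; rewrite ler_norml => *; lra.
Qed.

(* Positive on the range of a and negative on the range of b as soon as each
   point of either range has positive distance to the other one. *)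
Definition dist_diff (a b : nat -> R) (t : R) : R :=
  infn (fun n => `|t - b n|) - infn (fun n => `|t - a n|).

Lemma dist_diff_lip a b t s : `|dist_diff a b t - dist_diff a b s| <= 2 * `|t - s|.
Proof.
have lip c : `|infn (fun n => `|t - c n|) - infn (fun n => `|s - c n|)| <= `|t - s|.
  apply: infn_dist => // m; apply: le_trans (ler_dist_dist _ _) _.
  by rewrite opprB addrA subrK.
rewrite /dist_diff; have := lip a; have := lip b.
by rewrite !ler_norml => /andP[? ?] /andP[? ?]; apply/andP; split; lra.
Qed.

Lemma dist_diff_gt0 a b e n : 0 < e -> (forall m, e <= `|a n - b m|) ->
  0 < dist_diff a b (a n).
Proof.
move=> e0 en; rewrite /dist_diff subr_gt0.
apply: le_lt_trans (infn_le n _) _ => //.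
by rewrite subrr normr0; exact: lt_le_trans e0 (le_infn en).
Qed.

Lemma dist_diffN a b t : dist_diff a b t = - dist_diff b a t.
Proof. by rewrite opprB. Qed.

End infimum_of_sequence.

(** * Lengths near the identity *)

Section length_theory.
Context {R : realType} {G : topologicalGroupType} (N : G -> R).
Hypothesis lenN : is_length N.

Lemma length_ge0 x : 0 <= N x.
Proof.
have [N1 NV NM _ _] := lenN; have := NM x (x^-1)%g; rewrite mulgV N1 NV; lra.
Qed.

Lemma length_dist x y : `|N x - N y| <= N (x * y^-1)%g.
Proof.
have [_ NV NM _ _] := lenN.
have := NM (x * y^-1)%g y; have := NM (y * x^-1)%g x; rewrite !mulgVK.
have -> : N (y * x^-1)%g = N (x * y^-1)%g by rewrite -NV invgM invgK.
rewrite ler_norml => *; apply/andP; split; lra.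
Qed.

(* A cluster point p of y has length 0, so left translation by p^-1 preserves
   the length and brings the y n close to 1. *)
Lemma length_near1 (K : set G) (y : nat -> G) (V : set G) : compact K ->
  (forall x, N x < 2^-1 -> K x) -> N (y n) @[n --> \oo] --> 0 ->
  nbhs 1%g V -> exists x n, V x /\ N x = N (y n).
Proof.
have [N1 NV NM _ Nc] := lenN => cK NK y0 nV.
have ysmall e : 0 < e -> \forall n \near \oo, N (y n) < e.
  move=> e0; have /cvgr0Pnorm_lt/(_ e e0) := y0.
  by apply: filterS => n; apply: le_lt_trans; exact: ler_norm.
have yK : (y @ \oo) K.
  by apply: filterS (ysmall 2^-1 _) => [n /NK//|]; rewrite invr_gt0.
have [p [Kp pcl]] := cK _ _ yK.
have Np : N p = 0.
  apply/eqP; rewrite eq_le length_ge0 andbT; apply/ler_addgt0Pr => e e0.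
  have e2 : 0 < e / 2 by rewrite divr_gt0.
  have [z [/= ze zp]] := pcl _ _ (ysmall _ e2 : (y @ \oo) [set z | N z < e / 2])
    (near1_rmulg p (Nc _ e2)).
  have := NM (p * z^-1)%g z; rewrite mulgVK.
  have -> : N (p * z^-1)%g = N (z * p^-1)%g by rewrite -NV invgM invgK.
  by move: ze zp => /=; lra.
have Vp : nbhs p [set z | V (p^-1 * z)%g].
  by apply: (@continuous_lmulg G (p^-1)%g p); rewrite mulVg.
have yr : (y @ \oo) (range y) by exists 0%N => // n _; exists n.
have [_ [[n _ <-] Vn]] := pcl _ _ yr Vp.
exists (p^-1 * y n)%g, n; split=> //.
have := NM (p^-1)%g (y n); have := NM p (p^-1 * y n)%g.
by rewrite mulVKg NV Np => *; lra.
Qed.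

End length_theory.

(** * Sign changes obstruct a continuous phase *)

Section sign_obstruction.
Context {R : realType} {G : topologicalGroupType}.

(** Dividing by [1 + |F|] gives a bounded function and scales [F] and [|F|] by the same positive
    factor, so the phase [k] of the quotient serves [F] too. *)
Lemma F_space_unbounded (X : topologicalType) (F : X -> R[i]) :
  F_space R X -> continuous F ->
  exists2 k : X -> R[i], continuous k & forall x, F x = k x * `|F x|.
Proof.
move=> FX cF; pose w x := 1 + `|F x|.
have w0 x : 0 < w x by rewrite /w ltr_pwDl.
have cw : continuous w.
  by move=> x; apply: cvgD; [exact: cvg_cst|apply: cvg_norm; exact: cF].
have [|k [ck _] kF] := FX (fun x => F x / w x).
  split.
    move=> x; apply: cvgM; first exact: cF.
    by apply: cvgV; [rewrite gt_eqF|exact: cw].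
  apply/bounded_funP; exists 1 => x; rewrite -lecR -normrE /= normrM normfV.
  rewrite (ger0_norm (ltW (w0 x))) ler_pdivrMr// mul1r /w.
  by rewrite lerDr.
exists k => // x; have := kF x; rewrite normrM normfV (ger0_norm (ltW (w0 x))).
by rewrite mulrA => /(mulIf (invr_neq0 (lt0r_neq0 (w0 x)))).
Qed.

(** [k] is 1 where [F] is positive and -1 where it is negative. [length_near1] finds both kinds of
    points arbitrarily close to 1, so continuity would force both values at [theta 1]. *)
Lemma sign_not_F_space (N : G -> R) (K : set G) (y z : nat -> G)
    (phi : R -> R) (X : topologicalType) (theta : G -> X) (F : X -> R[i]) :
  is_length N -> compact K -> (forall x, N x < 2^-1 -> K x) ->
  N (y n) @[n --> \oo] --> 0 -> N (z n) @[n --> \oo] --> 0 ->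
  (forall n, 0 < phi (N (y n))) -> (forall n, phi (N (z n)) < 0) ->
  continuous theta -> continuous F ->
  (\forall x \near 1%g, F (theta x) = (phi (N x))%:C%C) ->
  ~ F_space R X.
Proof.
move=> lenN cK NK y0 z0 phiy phiz ct cF Ft FX.
have [k ck kF] := F_space_unbounded FX cF.
(* A value [c] taken arbitrarily close to 1 is taken at 1, because points of the plane are
   closed. *)
have val1 (c : R[i]) (u : nat -> G) : N (u n) @[n --> \oo] --> 0 ->
    (forall x n, N x = N (u n) -> F (theta x) = (phi (N x))%:C%C ->
       k (theta x) = c) -> k (theta 1%g) = c.
  move=> u0 uc; apply: contrapT => kc.
  have nV : \forall x \near 1%g, k (theta x) <> c.
    have ckt : {for 1%g, continuous (k \o theta)} by apply: continuous_comp; [exact: ct|exact: ck].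
    apply: (ckt (~` [set c])); apply: open_nbhs_nbhs; split=> //.
    exact/closed_openC/accessible_closed_set1/hausdorff_accessible/norm_hausdorff.
  have [x [n [[Vx Fx] xn]]] := length_near1 lenN cK NK u0 (filterI nV Ft).
  exact/Vx/uc/Fx/xn.
have /eqP : k (theta 1%g) = 1.
  apply: (val1 1 y) => // x n xy Fx; have := kF (theta x); rewrite Fx xy.
  rewrite ger0_norm ?lecR ?ltW// -[LHS]mul1r => /mulIf -> //.
  by rewrite gt_eqF ?ltcR.
rewrite (val1 (-1) z) => // [|x n xz Fx].
  by rewrite eq_sym -subr_eq0 opprK -(natrD _ 1 1) pnatr_eq0.
have := kF (theta x); rewrite Fx xz.
rewrite ltr0_norm ?ltcR// mulrN -mulNr -[LHS]mul1r => /mulIf ->; rewrite ?opprK//.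
by rewrite lt_eqF ?ltcR.
Qed.

End sign_obstruction.

(** * Complex limits by real estimates, and limits along ultrafilters *)

Lemma cvg_normcP (R : realType) (T : Type) (F : set_system T) (f : T -> R[i]) l :
  Filter F ->
  f @ F --> l <-> forall e : R, 0 < e -> \forall x \near F, normc (f x - l) <= e.
Proof.
move=> FF; split=> [/cvgrPdist_le fl e e0|fl].
  have := fl e%:C%C; rewrite ltcR => /(_ e0); apply: filterS => x.
  by rewrite distrC normrE lecR.
apply/cvgrPdist_le => e e0; have eE : e = (complex.Re e)%:C%C.
  by rewrite RRe_real// ger0_real// ltW.
rewrite eE ltcR in e0; apply: filterS (fl _ e0) => x.
by rewrite distrC normrE eE lecR.
Qed.

Lemma normc_real (R : realType) (x : R) : normc x%:C%C = `|x|.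
Proof. by rewrite /= expr0n /= addr0 sqrtr_sqr. Qed.

Lemma normc_le_ReIm (R : realType) (z : R[i]) :
  normc z <= `|complex.Re z| + `|complex.Im z|.
Proof.
case: z => a b /=; rewrite -[leRHS]ger0_norm ?addr_ge0// -sqrtr_sqr ler_sqrt.
  by rewrite sqrrD !real_normK ?num_real// lerD2r lerDl mulrn_wge0 ?mulr_ge0.
exact: sqr_ge0.
Qed.

Lemma Re_le_normc (R : realType) (z : R[i]) : `|complex.Re z| <= normc z.
Proof.
by case: z => a b /=; rewrite -sqrtr_sqr ler_sqrt ?addr_ge0 ?sqr_ge0// lerDl sqr_ge0.
Qed.

Lemma Im_le_normc (R : realType) (z : R[i]) : `|complex.Im z| <= normc z.
Proof.
by case: z => a b /=; rewrite -sqrtr_sqr ler_sqrt ?addr_ge0 ?sqr_ge0// lerDr sqr_ge0.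
Qed.

Section ultrafilter_limits.
Context {R : realType} {T : Type} (U : set_system T) {UU : UltraFilter U}.

(** Compactness gives a cluster point. An ultrafilter contains the preimage of each of its
    neighbourhoods or the complement, and clustering excludes the latter. *)
Lemma ultra_cvg_compact (X : topologicalType) (f : T -> X) (A : set X) :
  compact A -> (forall t, A (f t)) -> exists p : X, f @ U --> p.
Proof.
move=> cA fA; have fUA : U (f @^-1` A) by apply: filterE => t; exact: fA.
have [p [_ pcl]] := cA (f @ U) _ fUA.
exists p => V nV; have [//|UnV] := in_ultra_setVsetC (f @^-1` V) UU.
by have [x []] := pcl (~` V) V UnV nV.
Qed.

Lemma ultra_cvg_bounded (u : T -> R[i]) M : (forall t, normc (u t) <= M) ->
  exists l : R[i], u @ U --> l.
Proof.
move=> uM; have seg (f : T -> R) : (forall t, `|f t| <= normc (u t)) ->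
    exists p : R, f @ U --> p.
  move=> fu; apply: (@ultra_cvg_compact _ f `[- M, M]%classic).
    exact: segment_compact.
  by move=> t; rewrite /= in_itv /= -ler_norml (le_trans (fu t)).
have [a /cvgrPdist_le ca] := seg _ (fun t => Re_le_normc (u t)).
have [b /cvgrPdist_le cb] := seg _ (fun t => Im_le_normc (u t)).
exists (a +i* b)%C; apply/cvg_normcP => e e0.
have e2 : 0 < e / 2 by rewrite divr_gt0.
apply: filterS2 (ca _ e2) (cb _ e2) => t ta tb.
apply: le_trans (normc_le_ReIm _) _.
rewrite raddfB [complex.Im _]raddfB /= distrC [X in _ + X]distrC; lra.
Qed.

End ultrafilter_limits.

(** * Membership in LUC(G) and the topology of G^luc *)

Lemma is_LUC_modulus (R : realType) (G : topologicalGroupType) (h w : G -> R) M :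
  (forall z, `|h z| <= M) -> (forall g z, `|h (g * z)%g - h z| <= w g) ->
  (forall e, 0 < e -> \forall g \near 1%g, w g < e) ->
  (fun z => (h z)%:C%C) \in LUC_pred R G.
Proof.
move=> hM hw w0; apply/LUC_predP/is_LUCP; split; first split.
- move=> z; apply/cvg_normcP => e e0.
  apply: filterS (near1_rmulg z (w0 _ e0)) => y yz.
  rewrite -rmorphB normc_real; apply: le_trans (ltW yz).
  (* Writing [y] as [(y * z^-1) * z] lets the modulus for left translation also give continuity at
     [z]. *)
  by rewrite -{1}[y](mulgVK z).
- by apply/bounded_funP; exists M => z; rewrite normc_real.
- move=> g0 e e0; apply: filterS (near1_rmulg g0 (w0 _ e0)) => g gg z.
  rewrite -rmorphB normc_real; apply: le_trans (ltW gg).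
  by rewrite -{1}[g](mulgVK g0) -mulgA.
Qed.

Section luc_topology.
Context {R : realType} {G : topologicalGroupType}.

Lemma LUC_continuous (f : LUC R G) : continuous f.
Proof. by have /LUC_predP[[]] := valP f. Qed.

Lemma LUC_bounded (f : LUC R G) x : normc (f x) <= sup_norm f.
Proof. by apply: le_sup_norm; have /LUC_predP[[]] := valP f. Qed.

Lemma Gluc_eval_continuous (f : LUC R G) :
  continuous (fun p : Gluc R G => Gluc_fun p f).
Proof.
move=> p; apply: (@continuous_comp _ _ _ set_val (fun phi : {ptws LUC R G -> R[i]} => phi f)).
  exact: initial_continuous.
exact: (@proj_continuous _ (fun=> R[i]) f).
Qed.

(** The topology is initial twice over, as a subspace and as a product. *)
Lemma Gluc_continuous (T : topologicalType) (theta : T -> Gluc R G) :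
  (forall f : LUC R G, continuous (fun x => Gluc_fun (theta x) f)) ->
  continuous theta.
Proof.
move=> ct; apply: continuous_comp_initial => x.
apply/cvg_sup => f; apply: (@continuous_comp_initial _ _ R[i]) => y.
exact: ct.
Qed.

Lemma Gluc_inj_continuous : continuous (@Gluc_inj R G).
Proof. by apply: Gluc_continuous => f; exact: LUC_continuous. Qed.

End luc_topology.

(** * Characters as ultrafilter limits of point evaluations *)

Section ultrafilter_characters.
Context {R : realType} {G : topologicalGroupType}.
Context (U : set_system nat) {UU : UltraFilter U}.

Definition limit_eval (z : nat -> G) : LUC R G -> R[i] :=
  fun f => lim (f (z n) @[n --> U]).

Lemma cvg_limit_eval z (f : LUC R G) : f (z n) @[n --> U] --> limit_eval z f.
Proof.
by have [l /cvgP] := @ultra_cvg_bounded R nat U UU _ _ (fun n => LUC_bounded f (z n)).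
Qed.

Lemma limit_eval_unique z (f : LUC R G) l :
  f (z n) @[n --> U] --> l -> limit_eval z f = l.
Proof. exact/cvg_unique/cvg_limit_eval/norm_hausdorff. Qed.

Lemma limit_evalP z : is_character (limit_eval z).
Proof.
split.
- move=> a f h; apply: limit_eval_unique.
  by apply: cvgD; [apply: cvgM; [exact: cvg_cst|]|]; exact: cvg_limit_eval.
- exists 1 => f; rewrite mul1r; apply/ler_addgt0Pr => e e0.
  have /cvg_normcP/(_ e e0)/filter_ex[n fn] := @cvg_limit_eval z f.
  rewrite -[limit_eval z f](subKr (f (z n))) addrC.
  apply: le_trans (le_normcD _ _) _; rewrite normcN addrC.
  by rewrite lerD ?LUC_bounded.
- by move=> f h; apply: limit_eval_unique; apply: cvgM; exact: cvg_limit_eval.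
- exists 1; rewrite (@limit_eval_unique z 1 1) ?oner_neq0//.
  exact: cvg_cst.
Qed.

Definition limit_char (z : nat -> G) : Gluc R G :=
  exist _ (limit_eval z) (mem_set (limit_evalP z)).

(** Left uniform continuity of [f] bounds [f (y * g n) - f (x * g n)] uniformly in [n], and such a
    bound survives the limit along [U]. *)
Lemma limit_char_continuous (g : nat -> G) :
  continuous (fun x => limit_char (fun n => x * g n)%g).
Proof.
apply: Gluc_continuous => f x; apply/cvg_normcP => e e0.
have /LUC_predP/is_LUCP[_ /(_ x e e0)] := valP f.
apply: filterS => y fy; apply/ler_addgt0Pr => d d0.
have dU : (f (y * g n)%g - f (x * g n)%g) @[n --> U] -->
    Gluc_fun (limit_char (fun n => y * g n)%g) f -
    Gluc_fun (limit_char (fun n => x * g n)%g) f.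
  by apply: cvgB; exact: cvg_limit_eval.
have /cvg_normcP/(_ d d0)/filter_ex[n] := dU.
set u := f _ - _; set v := Gluc_fun _ _ - _ => uv.
rewrite -[v](subKr u); apply: le_trans (le_normcD _ _) _.
by rewrite normcN lerD// ?fy.
Qed.

End ultrafilter_characters.

(** * Dyadic sequences and their gaps *)

Lemma pow2_cvg_sub (R : realType) (t : nat -> R) (i : nat -> nat) :
  (forall n, 2 ^- n.+1 <= t n <= 2 ^- n) -> (forall n, (n <= i n)%N) ->
  t (i n) @[n --> \oo] --> 0.
Proof.
move=> tn ni; apply: (@squeeze_cvgr _ _ _ _ (fun=> 0) (geometric 1 2^-1)).
- apply: nearW => n; have /andP[ti1 ti2] := tn (i n).
  rewrite (le_trans (ltW (pow2_gt0 _ _)) ti1) /geometric /= mul1r exprVn.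
  exact: le_trans ti2 (pow2_le R (ni n)).
- exact: cvg_cst.
- by apply: cvg_geometric; rewrite ger0_norm; lra.
Qed.

(** Indices two apart leave a whole dyadic interval between the values. The bound depends on [i]
    alone, as [dist_diff_gt0] requires. *)
Lemma pow2_gap (R : realType) (t : nat -> R) i j :
  (forall n, 2 ^- n.+1 <= t n <= 2 ^- n) -> (i.+2 <= j)%N || (j.+2 <= i)%N ->
  2 ^- i.+2 <= `|t i - t j|.
Proof.
move=> tn ij; have /andP[ti1 ti2] := tn i; have /andP[tj1 tj2] := tn j.
have := pow2S R i; have := pow2S R i.+1.
have := @pow2_gt0 R i.+2; have := @ler_norm R (t i - t j).
have := ler_norm (t j - t i); rewrite distrC.
case/orP: ij => [/(pow2_le R) ij|]; first lra.
case: i => // i in ti1 ti2 *; rewrite ltnS => /(pow2_le R) ji.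
have := pow2S R i; lra.
Qed.

(** [4 * n] and [4 * m + 2] always differ by at least two. *)
Lemma dist_diff_pow2 (R : realType) (t : nat -> R) :
  (forall n, 2 ^- n.+1 <= t n <= 2 ^- n) ->
  let phi := dist_diff (fun n => t (4 * n)%N) (fun n => t (4 * n + 2)%N) in
  (forall n, 0 < phi (t (4 * n)%N)) /\ (forall n, phi (t (4 * n + 2)%N) < 0).
Proof.
move=> tn phi; split=> n.
  apply: (dist_diff_gt0 (a := fun n => t (4 * n)%N) (pow2_gt0 R (4 * n).+2)) => m.
  by apply: pow2_gap => //; lia.
rewrite /phi dist_diffN oppr_lt0.
apply: (dist_diff_gt0 (a := fun n => t (4 * n + 2)%N) (pow2_gt0 R (4 * n + 2).+2)) => m.
by apply: pow2_gap => //; lia.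
Qed.

(** * Separated sequences and the distance to them *)

Section length_functions.
Context {R : realType} {G : topologicalGroupType} (N : G -> R).
Hypothesis lenN : is_length N.

Lemma dist_diff_LUC (D : G -> R) a b : (forall z, 0 <= D z <= 1) ->
  (forall g z, `|D (g * z)%g - D z| <= N g) ->
  (fun z => (dist_diff a b (D z))%:C%C) \in LUC_pred R G.
Proof.
move=> D1 DN; have [_ _ _ _ N0] := lenN.
(* A 2-Lipschitz function on the unit interval stays within 2 of its value at 0. *)
apply: (is_LUC_modulus (w := fun g => 2 * N g) (M := 2 + `|dist_diff a b 0|)).
- move=> z; rewrite -lerBlDr.
  apply: le_trans (lerB_dist _ _) _; apply: le_trans (dist_diff_lip _ _ _ _) _.
  by have /andP[D0 ?] := D1 z; rewrite subr0 ger0_norm//; lra.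
- move=> g z; apply: le_trans (dist_diff_lip _ _ _ _) _.
  by rewrite ler_pM2l.
- move=> e e0; have e2 : 0 < e / 2 by rewrite divr_gt0.
  by apply: filterS (N0 _ e2) => g; lra.
Qed.

(** Finitely many right translates of [K] form a compact set and so miss a point; the sequence takes
    such points one after another. *)
Lemma separated_sequence (K : set G) : compact K ->
  (forall x, N x < 2^-1 -> K x) -> ~ compact [set: G] ->
  exists g : nat -> G, forall m n, m != n -> 2^-1 <= N (g n * (g m)^-1)%g.
Proof.
move=> cK NK ncG.
have next (s : seq G) : exists y, forall x, x \in s -> 2^-1 <= N (y * x^-1)%g.
  apply: contrapT => ns; apply: ncG.
  rewrite (_ : setT = \big[setU/set0]_(x <- s) [set (y * x)%g | y in K]).
    apply: bigsetU_compact => x _; apply: continuous_compact => //.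
    exact/continuous_subspaceT/continuous_rmulg.
  apply/esym; rewrite -subTset => y _.
  have /existsNP[x /not_implyP[xs /negP]] : ~ forall x, x \in s -> 2^-1 <= N (y * x^-1)%g.
    by move=> ys; apply: ns; exists y.
  rewrite -ltNge => /NK Kyx; rewrite -bigcup_seq; exists x => //.
  by exists (y * x^-1)%g => //; rewrite mulgVK.
have [nx nxP] := choice next.
pose hist n := iter n (fun s => nx s :: s) [::].
have histP m n : (m < n)%N -> nx (hist m) \in hist n.
  elim: n => // n IH; rewrite ltnS leq_eqVlt => /orP[/eqP->|/IH mn].
    by rewrite inE eqxx.
  by rewrite inE mn orbT.
exists (nx \o hist) => m n; have [_ NV _ _ _] := lenN.
rewrite neq_ltn => /orP[mn|nm]; first exact/nxP/histP.
by rewrite -NV invgM invgK; exact/nxP/histP.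
Qed.

Context (g : nat -> G).
Hypothesis gsep : forall m n, m != n -> 2^-1 <= N (g n * (g m)^-1)%g.

(** The distance from [z] to the range of [g] in the right-invariant pseudometric [N (x * y^-1)]. *)
Definition dist_range (z : G) : R := infn (fun m => N (z * (g m)^-1)%g).

Lemma dist_range_bounds z : 0 <= dist_range z <= 1.
Proof.
have [_ _ _ N1 _] := lenN; have N0 m := length_ge0 lenN (z * (g m)^-1)%g.
by rewrite le_infn//= (le_trans (infn_le 0%N _)).
Qed.

Lemma dist_range_lip x z : `|dist_range (x * z)%g - dist_range z| <= N x.
Proof.
apply: infn_dist => m; [exact: length_ge0|exact: length_ge0|].
apply: le_trans (length_dist lenN _ _) _.
by rewrite invgM invgK -!mulgA mulKg mulgV mulg1.
Qed.

(** All other points of the sequence are farther than 1/2 - 1/4 from [x * g n], so [g n] is a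
    nearest one. *)
Lemma dist_range_near n x : N x < 4^-1 -> dist_range (x * g n)%g = N x.
Proof.
have [_ NV NM _ _] := lenN => Nx; apply/eqP; rewrite eq_le; apply/andP; split.
  by apply: le_trans (infn_le n _) _ => [m|]; [exact: length_ge0|rewrite mulgK].
apply: le_infn => m; have [->|mn] := eqVneq m n; first by rewrite mulgK.
have := gsep mn; have := NM (x^-1)%g (x * g n * (g m)^-1)%g.
rewrite -!mulgA mulKg NV; lra.
Qed.

(** If the limit were a point [y], then [g n * (y^-1 * x)] would be short for [U]-many [n]; two such
    indices contradict the separation. *)
Lemma limit_char_notin (U : set_system nat) {UU : UltraFilter U} (x : G) :
  \oo `<=` U -> ~ range (@Gluc_inj R G) (limit_char (U := U) (fun n => x * g n)%g).
Proof.
have [N1 NV NM Nle N0] := lenN => Uoo [y _ yE].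
(* Chosen so that [h y = N 1 = 0] and [h (x * g n) = N (g n * (y^-1 * x))]. *)
pose h z := N (x^-1 * z * y^-1 * x)%g.
have hL : (fun z => (h z)%:C%C) \in LUC_pred R G.
  apply: (is_LUC_modulus (w := fun w => N (x^-1 * w * x)%g) (M := 1)).
  - by move=> z; rewrite ger0_norm ?(length_ge0 lenN)//; exact: Nle.
  - move=> w z; apply: le_trans (length_dist lenN _ _) _.
    by rewrite !invgM !invgK -!mulgA mulVKg mulKg mulVKg.
  - move=> e e0.
    have cj : (x^-1 * w * x)%g @[w --> 1%g] --> (x^-1 * 1 * x)%g.
      by apply: cvg_mulg; [apply: cvg_mulg; [exact: cvg_cst|exact: cvg_id]|exact: cvg_cst].
    by apply: (cj [set w | N w < e]); rewrite mulg1 mulVg; exact: N0.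
have l0 : limit_eval U (fun n => x * g n)%g (MkLUC hL) = 0.
  transitivity (Gluc_fun (Gluc_inj R y) (MkLUC hL)); first by rewrite yE.
  by rewrite [LHS](_ : _ = (h y)%:C%C)// /h mulgK mulVg N1.
have hU : \forall n \near U, N (g n * (y^-1 * x))%g <= 8^-1.
  have := @cvg_limit_eval R G U UU (fun n => x * g n)%g (MkLUC hL).
  rewrite l0 => /cvg_normcP/(_ (8^-1)); rewrite invr_gt0 ltr0n => /(_ isT).
  apply: filterS => n; rewrite subr0 [normc _]normc_real.
  by rewrite ger0_norm ?(length_ge0 lenN)// /h mulKg -!mulgA.
have [n hn] := filter_ex hU.
(* [U] contains the tails, so a second index beyond [n] is available. *)
have gtU : U [set m | (n < m)%N] by apply: Uoo; exists n.+1.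
have [m [nm hm]] := filter_ex (filterI gtU hU).
have := gsep (negbT (ltn_eqF nm)).
have := NM (g m * (y^-1 * x))%g (g n * (y^-1 * x))^-1%g.
rewrite NV !invgM !invgK -!mulgA mulVKg mulKg.
move: hn hm => /=; lra.
Qed.


End length_functions.

(** For compact [G] every character is a point evaluation, so G^* is empty and trivially an F-space;
    the second claim therefore concerns noncompact [G]. *)
Theorem theorem2p4 (R : realType) (G : topologicalGroupType) :
  hausdorff_space G -> locally_compact [set: G] ->
  ~ (forall A : set G, open A) ->
  ~ F_space R (Gluc R G) /\
  (~ compact [set: G] -> ~ F_space R (Gstar R G)).
Proof.
move=> hG lcG ndG.
have [N [K [x [lenN cK NK xN]]]] := length_exists R hG lcG ndG.
pose phi := dist_diff (fun n => N (x (4 * n)%N)) (fun n => N (x (4 * n + 2)%N)).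
have [phiy phiz] := dist_diff_pow2 xN.
have y0 : N (x (4 * n)%N) @[n --> \oo] --> 0.
  by apply: (pow2_cvg_sub (i := fun n => (4 * n)%N) xN) => n; lia.
have z0 : N (x (4 * n + 2)%N) @[n --> \oo] --> 0.
  by apply: (pow2_cvg_sub (i := fun n => (4 * n + 2)%N) xN) => n; lia.
have obstruction := sign_not_F_space lenN cK NK y0 z0 phiy phiz.
split=> [|ncG].
  have NL : (fun z => (phi (N z))%:C%C) \in LUC_pred R G.
    apply: (dist_diff_LUC lenN) => [z|g z].
      by have [_ _ _ N1 _] := lenN; rewrite (length_ge0 lenN) N1.
    by apply: le_trans (length_dist lenN _ _) _; rewrite mulgK.
  apply: (obstruction _ (@Gluc_inj R G) (fun p => Gluc_fun p (MkLUC NL))).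
  - exact: Gluc_inj_continuous.
  - exact: Gluc_eval_continuous.
  - by apply: nearW.
have [g gsep] := separated_sequence lenN cK NK ncG.
have [U [UU Uoo]] := ultraFilterLemma (@eventually_filter).
have DL := dist_diff_LUC lenN (fun n => N (x (4 * n)%N)) (fun n => N (x (4 * n + 2)%N))
  (dist_range_bounds lenN g) (dist_range_lip lenN g).
pose theta (w : G) : Gstar R G :=
  SigSub (mem_set (limit_char_notin lenN gsep (UU := UU) (x := w) Uoo :
    (~` range (@Gluc_inj R G)) (limit_char (UU := UU) (fun n => w * g n)%g))).
pose F (p : Gstar R G) : R[i] := Gluc_fun (set_val p) (MkLUC DL).
apply: (obstruction _ theta F).
- by apply: continuous_comp_initial; exact: limit_char_continuous.
- move=> p; apply: (@continuous_comp _ _ _ set_val (fun q : Gluc R G => Gluc_fun q (MkLUC DL))).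
    exact: initial_continuous.
  exact: Gluc_eval_continuous.
- have [_ _ _ _ N0] := lenN.
  (* Within the radius of [dist_range_near] the values along [w * g n] are constantly [phi (N w)],
     and so is their limit along [U]. *)
  apply: filterS (N0 4^-1 _) => [w wN|]; last by rewrite invr_gt0.
  apply: limit_eval_unique; rewrite /= (_ : (fun n => _) = fun=> (phi (N w))%:C%C).
    exact: cvg_cst.
  by apply/funext => n /=; rewrite (dist_range_near lenN gsep).
Qed.
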